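(* Let $k\ge1$ be a fixed integer and let $P_Y$ be the probability generating function of a probability distribution on $\mathbf{Z_+}=\{0,1,2,\dots\}$. Suppose that for each $c\in(0,1]$ and each $p\in[0,1)$ there is a stationary generalized INAR(1) model $\{Y_{n,i}\}$ with parameters $(k,c,p)$ (as defined in the context), that is, $$\sum_{i=1}^k Y_{n,i}=\begin{cases}\sum_{i=1}^k\epsilon_{n,i}, & \text{with probability } p,\\ \sum_{i=1}^k c\odot Y_{n-1,i}+\sum_{i=1}^k\epsilon_{n,i}, & \text{with probability } 1-p,\end{cases}\qquad n\in\mathbb{Z},$$ in which every $Y_{n,i}$ has probability generating function $P_Y$ (the law of the innovations $\epsilon_{n,i}$ may depend on $c$ and $p$). Then the distribution of $Y_{n,i}$, i.e. $P_Y$, is discrete Harris-randomly self-decomposable (DHRSD).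
   Context: PGF means the probability generating function, on $s\in[0,1]$, of a probability distribution on $\mathbf{Z_+}=\{0,1,2,\dots\}$; $P^k(s)=(P(s))^k$. Fix an integer $k\ge1$. All $k$-th roots are non-negative real roots. Binomial thinning (Steutel and van Harn): for a $\mathbf{Z_+}$-valued random variable $Y$ and $c\in(0,1]$, $c\odot Y=\sum_{j=1}^{Y}B_j$, where $B_1,B_2,\dots$ are i.i.d. Bernoulli random variables with $\Pr(B_j=1)=c$, independent of $Y$; thus if $Y$ has PGF $P$ then $c\odot Y$ has PGF $P(1-c+cs)$. Stationary generalized INAR(1) model with parameters $(k,c,p)$: $\mathbf{Z_+}$-valued random variables $Y_{n,i}$, $\epsilon_{n,i}$ ($n\in\mathbb{Z}$, $1\le i\le k$) such that: for each $n$, $Y_{n,1},\dots,Y_{n,k}$ are i.i.d.; the innovations $\epsilon_{n,i}$ are i.i.d.; for each $n$, the innovations $(\epsilon_{n,1},\dots,\epsilon_{n,k})$ are independent of $(Y_{n-1,1},\dots,Y_{n-1,k})$ and of the Bernoulli variables used in the thinnings $c\odot Y_{n-1,i}$, and these Bernoulli variables are independent over $i$ and independent of $(Y_{n-1,i})_i$; the displayed relation for $\sum_i Y_{n,i}$ holds for each $n$, where the choice between the two cases (first case with probability $p$, second with probability $1-p$) is made independently of $(Y_{n-1,i})_i$, $(\epsilon_{n,i})_i$ and the thinning variables; and the process $\{(Y_{n,1},\dots,Y_{n,k})\}_{n\in\mathbb{Z}}$ is stationary. Discrete Harris-randomly self-decomposable (DHRSD): a PGF $P$ is DHRSD if for each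 $c\in(0,1]$ and $p\in[0,1)$ there exists a PGF $P_{c,p}$ such that $$P(s)=P_{c,p}(s)\{p+(1-p)P^{k}(1-c+cs)\}^{1/k}\quad\text{for all }s\in[0,1].$$ *)

(* Defs.v *)
From HB Require Import structures.
From mathcomp Require Import all_boot all_order all_algebra.
From mathcomp Require Import all_classical all_reals all_analysis.

Set Implicit Arguments.
Unset Strict Implicit.
Unset Printing Implicit Defensive.

Import Order.TTheory GRing.Theory Num.Theory.

Local Open Scope classical_set_scope.
Local Open Scope ring_scope.

(* Only the values of [P] on [0, 1] are constrained. *)
Definition has_pgf (R : realType) (mu : probability nat R) (P : R -> R) : Prop :=
  forall s : R, 0 <= s <= 1 ->
    (\sum_(0 <= j <oo) mu [set j] * (s ^+ j)%:E = (P s)%:E)%E.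

Definition is_pgf (R : realType) (P : R -> R) : Prop :=
  exists mu : probability nat R, has_pgf mu P.

Definition dhrsd (R : realType) (k : nat) (P : R -> R) : Prop :=
  is_pgf P /\
  forall c p : R, 0 < c <= 1 -> 0 <= p < 1 ->
    exists2 Pcp : R -> R, is_pgf Pcp &
      forall s : R, 0 <= s <= 1 ->
        P s = Pcp s * (p + (1 - p) * P (1 - c + c * s) ^+ k) `^ (k%:R^-1).

Section independence.
Context (R : realType) (d : measure_display) (T : measurableType d).

Definition sigma_rv (d' : measure_display) (T' : measurableType d') (I : Type)
    (X : I -> T -> T') : set (set T) :=
  <<s \bigcup_i preimage_set_system setT (X i) measurable >>.

Definition indep_sigma (Q : probability T R) (F G : set (set T)) : Prop :=
  forall A B : set T, F A -> G B -> Q (A `&` B) = (Q A * Q B)%E.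

Definition mutually_indep (Q : probability T R) (d' : measure_display)
    (T' : measurableType d') (I : eqType) (X : I -> {RV Q >-> T'}) : Prop :=
  forall (J : seq I) (A : I -> set T'), uniq J ->
    (forall i, measurable (A i)) ->
    Q (\bigcap_(i in [set` J]) (X i @^-1` A i)) =
      (\prod_(i <- J) Q (X i @^-1` A i))%E.

Definition iid (Q : probability T R) (d' : measure_display)
    (T' : measurableType d') (I : eqType) (X : I -> {RV Q >-> T'}) : Prop :=
  mutually_indep X /\
  forall (i j : I) (A : set T'), measurable A ->
    distribution Q (X i) A = distribution Q (X j) A.

(* Equality of all finite-dimensional distributions under time shifts; as
   ['I_m -> 'I_k -> nat] is countable, every [A] below is a legitimate event. *)
Definition stationary (k : nat) (Q : probability T R)
    (Y : int -> 'I_k -> {RV Q >-> nat}) : Prop :=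
  forall (m : nat) (t : 'I_m -> int) (h : int) (A : set ('I_m -> 'I_k -> nat)),
    Q [set w | A (fun a i => Y (t a + h) i w)] =
    Q [set w | A (fun a i => Y (t a) i w)].

End independence.

(* The value of [c (.) Y] when [B] is the i.i.d. Bernoulli(c) sequence. *)
Definition thinning (T : Type) (B : nat -> T -> bool) (Y : T -> nat) (w : T) : nat :=
  (\sum_(0 <= j < Y w) B j w)%N.

(* [B n i] is the Bernoulli sequence thinning [Y (n - 1) i], and [D n] is the
   choice made at time [n]: [true] discards the previous generation. The law of
   [(D n, B n)] is only constrained separately for each [n]. *)
Record stationary_inar1 (R : realType) (k : nat) (c p : R)
    (d : measure_display) (T : measurableType d) (Q : probability T R)
    (Y eps : int -> 'I_k -> {RV Q >-> nat})
    (B : int -> 'I_k -> nat -> {RV Q >-> bool})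
    (D : int -> {RV Q >-> bool}) : Prop := {
  inar1_Y_iid : forall n, iid (Y n);
  inar1_eps_iid : iid (fun ni : int * 'I_k => eps ni.1 ni.2);
  inar1_B_indep : forall n, mutually_indep (fun ij : 'I_k * nat => B n ij.1 ij.2);
  inar1_B_law : forall n i j, Q [set w | B n i j w = true] = c%:E;
  inar1_B_Y : forall n,
    indep_sigma Q (sigma_rv (fun ij : 'I_k * nat => B n ij.1 ij.2))
                  (sigma_rv (Y (n - 1)));
  inar1_eps_YB : forall n,
    indep_sigma Q (sigma_rv (eps n))
      <<s sigma_rv (Y (n - 1)) `|`
          sigma_rv (fun ij : 'I_k * nat => B n ij.1 ij.2) >>;
  inar1_D_law : forall n, Q [set w | D n w = true] = p%:E;
  inar1_D_YepsB : forall n,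
    indep_sigma Q (sigma_rv (fun _ : unit => D n))
      <<s sigma_rv (Y (n - 1)) `|` sigma_rv (eps n) `|`
          sigma_rv (fun ij : 'I_k * nat => B n ij.1 ij.2) >>;
  inar1_rec : forall n, {ae Q, forall w : T,
    (\sum_(i < k) Y n i w)%N =
      if D n w then (\sum_(i < k) eps n i w)%N
      else ((\sum_(i < k) thinning (B n i) (Y (n - 1)%R i) w)
            + (\sum_(i < k) eps n i w))%N};
  inar1_stationary : stationary Y
}.

(* Main.v *)
Require Import Defs.
From HB Require Import structures.
From mathcomp Require Import all_boot all_order all_algebra.
From mathcomp Require Import all_classical all_reals all_analysis.
From mathcomp Require Import measurable_realfun.

Set Implicit Arguments.
Unset Strict Implicit.
Unset Printing Implicit Defensive.

Import Order.TTheory GRing.Theory Num.Theory.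

Local Open Scope classical_set_scope.
Local Open Scope ring_scope.

(** Conditioning does all the work. Let [G s N] be the expectation of [s ^+ N];
    below it is called [gf]. Fix [c], [p] and one time [n], write [E] for the sum
    of the innovations and [S] for the sum of the thinned variables, and put
    [t = 1 - c + c * s]. The choice variable is independent of [(S, E)] and [S]
    is independent of [E], so the recursion gives
      [G s (sum of the Y n i) = G s E * (p + (1 - p) * G s S)].
    Conditionally on the whole vector [Y (n - 1) = f], [S] is a sum of
    [\sum_i f i] independent Bernoulli variables, each with generating function
    [t]; hence [G s S = G t (sum of the Y (n - 1) i)]. Independence over [i]
    turns the generating functions of the sums into [k]-th powers, and
      [PY s ^+ k = Pe s ^+ k * (p + (1 - p) * PY t ^+ k)]
    where [Pe] is the generating function of one innovation. Everything is
    non-negative, so [k]-th roots give the required factorisation, with [Pe] as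
    the factor. A single step of the recursion suffices, as [Y n i] and
    [Y (n - 1) i] have the same law.

    Every random variable here takes countably many values. Measurability is
    therefore tested on fibers, which makes a random index harmless
    ([measurable_fibers_bind]), and an identity between integrals is tested on
    the fibers of any such variable ([eq_integral_fibers]). Product formulas,
    conditioning on [Y (n - 1)] and the two cases of the recursion
    ([integral_prod_indep], [gf_indepD], [gf_sum_thinning], [gf_choice]) all
    reduce to these two facts; [stationary_inar1_gf] assembles them. *)

(** * Random variables with countably many values *)

(** For countable [C] this is measurability for the discrete sigma-algebra; it
    does not require a measurable structure on [C], so that [C] can be a type of
    finite functions. *)
Definition measurable_fibers d (T : measurableType d) (C : Type) (X : T -> C) :=
  forall c : C, measurable (X @^-1` [set c]).

(** The same notion for the sigma-algebra generated by [G] in place of that of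
    the ambient space: lemmas on [measurable_fibers] thereby also show that an
    event belongs to the sigma-algebra of a family of variables. *)
Definition fibers_in (T : pointedType) (G : set (set T)) (C : Type) (X : T -> C) :=
  @measurable_fibers _ (g_sigma_algebraType G) C X.

Lemma measurable_preimage_fibers d (T : measurableType d) (C : countType)
    (X : T -> C) (A : set C) :
  measurable_fibers X -> measurable (X @^-1` A).
Proof.
move=> mX.
have -> : X @^-1` A = \bigcup_(c : C) (X @^-1` (A `&` [set c])).
  apply/seteqP; split => [w Aw|w [c _ []]//].
  by exists (X w).
apply: countable_bigcupT_measurable => [|c]; first exact: countableP.
have [Ac|nAc] := pselect (A c).
  by rewrite setIidr// => _ ->.
rewrite (_ : A `&` _ = set0) ?preimage_set0// -subset0 => x [Ax xc].
by apply: nAc; rewrite -xc.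
Qed.

Lemma measurable_fibers_fun d (T : measurableType d) (C : countType)
    (X : T -> C) d' (U : measurableType d') (h : C -> U) (D : set T) :
  measurable_fibers X -> measurable_fun D (h \o X).
Proof.
move=> mX; apply: measurable_funTS => _ A mA; rewrite setTI comp_preimage.
exact: measurable_preimage_fibers.
Qed.

(** The value of a countable family at a random index: the fiber at [b] is the
    countable union over [c] of the events where [X] is [c] and [Z c] is [b].
    The random number of summands in a thinning is handled by this lemma. *)
Lemma measurable_fibers_bind d (T : measurableType d) (C : countType) (C' : Type)
    (X : T -> C) (Z : C -> T -> C') :
  measurable_fibers X -> (forall c, measurable_fibers (Z c)) ->
  measurable_fibers (fun w => Z (X w) w).
Proof.
move=> mX mZ b.
rewrite (_ : _ @^-1` _ = \bigcup_(c : C)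
   (X @^-1` [set c] `&` Z c @^-1` [set b])).
  apply: countable_bigcupT_measurable => [|c]; first exact: countableP.
  by apply: measurableI; [exact: mX|exact: mZ].
apply/seteqP; split => [w Zb|w [c _ [/= <-]]//].
by exists (X w).
Qed.

Lemma measurable_fibers_cst d (T : measurableType d) (C : Type) (c : C) :
  measurable_fibers (fun _ : T => c).
Proof. by move=> b; rewrite preimage_cst; case: ifP. Qed.

Lemma measurable_fibers_comp2 d (T : measurableType d) (C1 C2 : countType)
    (C : Type) (op : C1 -> C2 -> C) (X : T -> C1) (Y : T -> C2) :
  measurable_fibers X -> measurable_fibers Y ->
  measurable_fibers (fun w => op (X w) (Y w)).
Proof.
move=> mX mY.
apply: (@measurable_fibers_bind _ _ _ _ X (fun x w => op x (Y w)) mX) => x.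
apply: (@measurable_fibers_bind _ _ _ _ Y (fun y w => op x y) mY) => y.
exact: measurable_fibers_cst.
Qed.

Lemma measurable_fibers_sum d (T : measurableType d) (I : Type) (r : seq I)
    (X : I -> T -> nat) :
  (forall i, measurable_fibers (X i)) ->
  measurable_fibers (fun w => \sum_(i <- r) X i w)%N.
Proof.
move=> mX; elim: r => [|i r IHr].
  by under eq_fun do rewrite big_nil; exact: measurable_fibers_cst.
under eq_fun do rewrite big_cons.
by apply: (@measurable_fibers_comp2 _ _ _ _ _ addn).
Qed.

Lemma measurable_fibers_count d (T : measurableType d) (I : Type) (r : seq I)
    (B : I -> T -> bool) :
  (forall i, measurable_fibers (B i)) ->
  measurable_fibers (fun w => \sum_(i <- r) B i w)%N.
Proof.
move=> mB.
apply: (@measurable_fibers_sum _ _ _ _ (fun i w => B i w : nat)) => i.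
apply: (measurable_fibers_bind (Z := fun (b : bool) w => b : nat) (mB i)) => b.
exact: measurable_fibers_cst.
Qed.

Lemma measurable_fibers_thinning d (T : measurableType d)
    (B : nat -> T -> bool) (Y : T -> nat) :
  (forall j, measurable_fibers (B j)) -> measurable_fibers Y ->
  measurable_fibers (thinning B Y).
Proof.
move=> mB mY.
apply: (measurable_fibers_bind
  (Z := fun y w => (\sum_(0 <= j < y) B j w)%N) mY) => y.
exact: measurable_fibers_count.
Qed.

Lemma measurable_fibers_finfun d (T : measurableType d) (I : finType)
    (C : countType) (X : I -> T -> C) :
  (forall i, measurable_fibers (X i)) ->
  measurable_fibers (fun w => [ffun i => X i w]).
Proof.
move=> mX f.
rewrite (_ : _ @^-1` _ = \big[setI/setT]_(i : I) (X i @^-1` [set f i])).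
  by apply: bigsetI_measurable => i _; exact: mX.
rewrite -bigcap_seq; apply/seteqP; split => w /=.
  by move=> <- i _ /=; rewrite ffunE.
by move=> Xf; apply/ffunP => i; rewrite ffunE; apply: Xf; rewrite /= mem_index_enum.
Qed.

(** Conditioning on a countably-valued variable: its fibers partition the space,
    and on each fiber that variable may be treated as a constant. *)
Lemma eq_integral_fibers d (T : measurableType d) (R : realType)
    (mu : measure T R) (C : countType) (X : T -> C) (f g : T -> \bar R) :
  measurable_fibers X ->
  measurable_fun setT f -> measurable_fun setT g ->
  (forall w, 0 <= f w)%E -> (forall w, 0 <= g w)%E ->
  (forall c, \int[mu]_(w in X @^-1` [set c]) f w =
             \int[mu]_(w in X @^-1` [set c]) g w)%E ->
  (\int[mu]_w f w = \int[mu]_w g w)%E.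
Proof.
move=> mX mf mg f0 g0 fg.
(* [pickle] indexes the fibers by [nat]; codes of no value give empty sets. *)
pose F n := (pickle \o X) @^-1` [set n].
have mF n : measurable (F n).
  by rewrite /F comp_preimage; exact: measurable_preimage_fibers.
have tF : trivIset setT F by exact: trivIset_preimage1.
have FT : [set: T] = \bigcup_n F n.
  by apply/seteqP; split => // w _; exists (pickle (X w)).
rewrite {}FT.
rewrite !ge0_integral_bigcup//; do 2? exact: measurable_funTS.
apply: eq_eseriesr => n _; rewrite /F comp_preimage.
have [[c cn]|nC] := pselect (exists c : C, pickle c = n); last first.
  rewrite (_ : pickle @^-1` _ = set0) ?preimage_set0 ?integral_set0//.
  by rewrite -subset0 => c /= cn; apply: nC; exists c.
rewrite (_ : pickle @^-1` _ = [set c]) ?fg//.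
apply/seteqP; split => [c'|c' -> //] /=.
by rewrite -cn => /(pcan_inj pickleK).
Qed.

(** * Product formulas under independence *)

Lemma integral_indep_event d (T : measurableType d) (R : realType)
    (Q : probability T R) (A : set T) (C : countType) (Z : T -> C) (h : C -> R) :
  measurable A -> measurable_fibers Z -> (forall c, 0 <= h c) ->
  (forall c, Q (A `&` Z @^-1` [set c]) = Q A * Q (Z @^-1` [set c]))%E ->
  (\int[Q]_(w in A) (h (Z w))%:E = Q A * \int[Q]_w (h (Z w))%:E)%E.
Proof.
move=> mA mZ h0 AZ.
have mhZ : measurable_fun setT (fun w => (h (Z w))%:E).
  exact: (measurable_fibers_fun (EFin \o h) mZ).
have hZ0 w : (0 <= (h (Z w))%:E)%E by rewrite lee_fin.
rewrite -ge0_integralZl// [LHS]integral_mkcond.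
apply: (eq_integral_fibers mZ) => [||w|w|c].
- by apply/(measurable_restrictT _ mA).1/measurable_funTS.
- exact: measurable_funeM.
- by rewrite patchE; case: ifP.
- by rewrite mule_ge0.
rewrite -integral_mkcondr ge0_integralZl//; first last.
- exact: measurable_funTS.
have hc D : measurable D -> D `<=` Z @^-1` [set c] ->
    (\int[Q]_(w in D) (h (Z w))%:E = (h c)%:E * Q D)%E.
  move=> mD Dc; rewrite -integral_cst//; apply: eq_integral => w /set_mem wD.
  by rewrite (Dc w wD).
rewrite !hc//; last by apply: measurableI.
by rewrite setIC AZ muleCA.
Qed.

(** By induction on [r], for the integral over an event fixing the values of
    further variables, with indices [r'] outside [r]. Conditioning on [X i = c]
    moves [i] from [r] to [r'], so the induction only meets events that prescribe
    values, whose probabilities are products by hypothesis. *)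
Lemma integral_prod_indep d (T : measurableType d) (R : realType)
    (Q : probability T R) (I : choiceType) (C : countType) (X : I -> T -> C)
    (h : I -> C -> R) (r : seq I) :
  (forall i, measurable_fibers (X i)) -> (forall i c, 0 <= h i c) ->
  (forall (J : seq I) (a : I -> C), uniq J ->
    Q (\bigcap_(i in [set` J]) X i @^-1` [set a i]) =
    (\prod_(i <- J) Q (X i @^-1` [set a i]))%E) ->
  uniq r ->
  (\int[Q]_w (\prod_(i <- r) h i (X i w))%:E =
   \prod_(i <- r) \int[Q]_w (h i (X i w))%:E)%E.
Proof.
move=> mX h0 indX.
pose E (a : I -> C) r' := \big[setI/setT]_(i <- r') X i @^-1` [set a i].
have mE a r' : measurable (E a r').
  by apply: bigsetI_measurable => i _; exact: mX.
have mh i : measurable_fun setT (fun w => h i (X i w)).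
  exact: (measurable_fibers_fun (h i) (mX i)).
have mp s : measurable_fun setT (fun w => (\prod_(i <- s) h i (X i w))%:E).
  by apply/measurable_EFinP/measurable_prod => i _.
have p0 s w : (0 <= (\prod_(i <- s) h i (X i w))%:E)%E.
  by rewrite lee_fin prodr_ge0.
have ip0 s : (0 <= \prod_(i <- s) \int[Q]_w (h i (X i w))%:E)%E.
  by apply: prode_ge0 => i _; apply: integral_ge0 => w _; rewrite lee_fin.
suff H r' a : uniq (r ++ r') ->
    (\int[Q]_(w in E a r') (\prod_(i <- r) h i (X i w))%:E =
     Q (E a r') * \prod_(i <- r) \int[Q]_w (h i (X i w))%:E)%E.
  case: r H => [_ _|i r H ur].
    under eq_integral do rewrite big_nil.
    by rewrite big_nil integral_cst// mul1e; exact: probability_setT.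
  (* No value is prescribed by the empty list; the space is pointed, which
     provides some family of values to pass. *)
  have := H [::] (X^~ point); rewrite cats0 => /(_ ur).
  by rewrite /E big_nil probability_setT mul1e.
elim: r r' a => [|i r IHr] r' a /=.
  move=> _; under eq_integral do rewrite big_nil.
  by rewrite big_nil integral_cst// mul1e mule1.
move=> /andP[]; rewrite mem_cat negb_or => /andP[ir ir'] urr'.
rewrite big_cons muleCA -ge0_integralZr//; last by rewrite mule_ge0.
- rewrite [LHS]integral_mkcond; apply: (eq_integral_fibers (mX i)) => [||w|w|c].
  + exact/(measurable_restrictT _ (mE _ _)).1/measurable_funTS.
  + by apply: emeasurable_funM => //; apply/measurable_EFinP.
  + by rewrite patchE; case: ifP.
  + by rewrite !mule_ge0// lee_fin.
  rewrite -integral_mkcondr.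
  pose a' := [eta a with i |-> c].
  have EE : E a' r' = E a r'.
    apply: eq_big_seq => j jr' /=; case: eqP => // ji.
    by rewrite -ji jr' in ir'.
  have Ec : X i @^-1` [set c] `&` E a r' = E a' (i :: r').
    by rewrite /E big_cons /= eqxx -/(E a' r') EE.
  have ur' : uniq (i :: r').
    by rewrite /= ir'; move: urr'; rewrite cat_uniq; case/and3P.
  have urir' : uniq (r ++ i :: r').
    by rewrite -cat1s uniq_catCA /= mem_cat negb_or ir ir'.
  have QE : (Q (E a' (i :: r')) = Q (X i @^-1` [set c]) * Q (E a r'))%E.
    rewrite -EE /E -!bigcap_seq [LHS](indX (i :: r') a')// [in RHS](indX r' a').
      by rewrite big_cons /= eqxx.
    by case/andP: ur'.
  transitivity (\int[Q]_(w in E a' (i :: r'))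
      ((h i c)%:E * (\prod_(i <- r) h i (X i w))%:E))%E.
    rewrite Ec; apply: eq_integral => w /set_mem.
    rewrite -Ec => -[/= <- _].
    by rewrite big_cons EFinM.
  rewrite ge0_integralZl//; [|exact: measurable_funTS|by rewrite lee_fin].
  rewrite IHr// QE.
  transitivity (\int[Q]_(w in X i @^-1` [set c])
     cst ((h i c)%:E * (Q (E a r') * \prod_(i <- r) \int[Q]_w (h i (X i w))%:E)) w)%E.
    rewrite integral_cst; last exact: mX.
    by rewrite -!muleA; congr (_ * _)%E; rewrite [LHS]muleC -!muleA.
  by apply: eq_integral => w /set_mem /= ->.
- by apply/measurable_EFinP.
- by move=> w _; rewrite lee_fin.
Qed.

(** * Events and families of random variables *)

Lemma measurable_fibers_mfun d (T : measurableType d) d' (C : measurableType d')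
    (X : {mfun T >-> C}) :
  (forall c : C, measurable [set c]) -> measurable_fibers X.
Proof. by move=> mC c; rewrite -[_ @^-1` _]setTI; exact: measurable_funP. Qed.

Lemma sigma_rv_fibers d (T : measurableType d) d' (C : measurableType d')
    (I : Type) (X : I -> T -> C) (i : I) :
  (forall c : C, measurable [set c]) -> fibers_in (sigma_rv X) (X i).
Proof.
move=> mC c; apply: sub_gen_smallest; apply: sub_gen_smallest; exists i => //.
by exists [set c] => //; rewrite setTI.
Qed.

Lemma fibers_in_sub (T : pointedType) (G H : set (set T)) (C : Type) (X : T -> C) :
  G `<=` H -> fibers_in G X -> fibers_in H X.
Proof. by move=> GH GX c; exact: (sub_sigma_algebra2 GH (GX c)). Qed.

(** [sigma_rv X] is already a sigma-algebra, so that generating one from it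
    adds no event. *)
Lemma fibers_in_sigma_rv d (T : measurableType d) d' (C : measurableType d')
    (I : Type) (X : I -> T -> C) (C' : Type) (Z : T -> C') :
  fibers_in (sigma_rv X) Z -> forall c, sigma_rv X (Z @^-1` [set c]).
Proof.
move=> mZ c; have := mZ c; apply: smallest_sub => //.
exact: smallest_sigma_algebra.
Qed.

Lemma mutually_indep_fibers d (T : measurableType d) (R : realType)
    (Q : probability T R) d' (C : measurableType d') (I : choiceType)
    (X : I -> {RV Q >-> C}) :
  (forall c : C, measurable [set c]) -> mutually_indep X ->
  forall (J : seq I) (a : I -> C), uniq J ->
    Q (\bigcap_(i in [set` J]) X i @^-1` [set a i]) =
    (\prod_(i <- J) Q (X i @^-1` [set a i]))%E.
Proof. by move=> mC indX J a uJ; exact: indX. Qed.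

Lemma mutually_indep_can d (T : measurableType d) (R : realType)
    (Q : probability T R) d' (C : measurableType d') (I J : choiceType)
    (f : I -> J) (g : J -> I) (X : J -> {RV Q >-> C}) :
  cancel f g -> mutually_indep X -> mutually_indep (X \o f).
Proof.
move=> fK indX r A ur mA.
have := indX (map f r) (A \o g).
rewrite (map_inj_uniq (can_inj fK)) => /(_ ur (fun=> mA _)).
rewrite !bigcap_seq !big_map.
by under eq_bigr do rewrite /= fK; under [in RHS]eq_bigr do rewrite /= fK.
Qed.

(** * Generating functions *)

Definition gf d (T : measurableType d) (R : realType) (Q : probability T R)
    (s : R) (N : T -> nat) : \bar R := (\int[Q]_w (s ^+ N w)%:E)%E.

Section gf.
Context d (T : measurableType d) (R : realType) (Q : probability T R).
Implicit Types (s c p : R) (M N : T -> nat).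

Lemma gf_distribution s (N : {RV Q >-> nat}) : 0 <= s ->
  gf Q s N = (\sum_(0 <= j <oo) distribution Q N [set j] * (s ^+ j)%:E)%E.
Proof.
move=> s0; have mN : measurable_fibers N by exact: measurable_fibers_mfun.
have -> : gf Q s N =
    (\int[Q]_(w in \bigcup_j N @^-1` [set j]) (s ^+ N w)%:E)%E.
  congr (integral _ _ _); apply/seteqP; split => // w _.
  by exists (N w).
rewrite ge0_integral_bigcup//; first last.
- exact: trivIset_preimage1.
- by move=> w _; rewrite lee_fin exprn_ge0.
- exact: (measurable_fibers_fun (fun j => (s ^+ j)%:E) mN).
apply: eq_eseriesr => j _; rewrite muleC -(integral_cst Q (mN j)).
by apply: eq_integral => w /set_mem /= ->.
Qed.

Lemma gf_sum (I : choiceType) (r : seq I) (X : I -> {RV Q >-> nat}) s :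
  uniq r -> mutually_indep X -> 0 <= s ->
  gf Q s (fun w => \sum_(i <- r) X i w)%N = (\prod_(i <- r) gf Q s (X i))%E.
Proof.
move=> ur indX s0; rewrite /gf.
under eq_integral do rewrite expr_sum.
apply: (@integral_prod_indep _ _ _ Q I nat X (fun _ j => s ^+ j)) => //.
- by move=> i; exact: measurable_fibers_mfun.
- by move=> i j; rewrite exprn_ge0.
- exact: mutually_indep_fibers.
Qed.

Lemma probability_false p (D : {RV Q >-> bool}) :
  Q [set w | D w = true] = p%:E -> Q (D @^-1` [set false]) = (1 - p)%:E.
Proof.
move=> Dp; have mD : measurable_fibers D by exact: measurable_fibers_mfun.
have -> : D @^-1` [set false] = ~` (D @^-1` [set true]).
  by apply/seteqP; split => w /=; case: (D w).
rewrite probability_setC; last exact: mD.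
by rewrite [Q _]Dp.
Qed.

Lemma integral_split_bool (D : {RV Q >-> bool}) (f : T -> \bar R) :
  measurable_fun setT f -> (forall w, 0 <= f w)%E ->
  (\int[Q]_w f w = \int[Q]_(w in D @^-1` [set true]) f w +
                   \int[Q]_(w in D @^-1` [set false]) f w)%E.
Proof.
move=> mf f0; have mD : measurable_fibers D by exact: measurable_fibers_mfun.
have -> : [set: T] = D @^-1` [set true] `|` D @^-1` [set false].
  by apply/seteqP; split => // w _ /=; case: (D w); [left|right].
rewrite ge0_integral_setU//; first exact: measurable_funTS.
by apply/disj_setPS => w [/= ->].
Qed.

Lemma gf_bernoulli s c (B : {RV Q >-> bool}) :
  0 <= s -> Q [set w | B w = true] = c%:E ->
  (\int[Q]_w (s ^+ B w)%:E = (1 - c + c * s)%:E)%E.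
Proof.
move=> s0 Bc; have mB : measurable_fibers B by exact: measurable_fibers_mfun.
rewrite (integral_split_bool B); first last.
- by move=> w; rewrite lee_fin exprn_ge0.
- exact: (measurable_fibers_fun (fun b : bool => (s ^+ b)%:E) mB).
have sB b : (\int[Q]_(w in B @^-1` [set b]) (s ^+ B w)%:E =
    (s ^+ b)%:E * Q (B @^-1` [set b]))%E.
  rewrite -integral_cst; last exact: mB.
  by apply: eq_integral => w /set_mem /= ->.
rewrite !sB (probability_false Bc) [Q _]Bc -!EFinM -EFinD expr1 expr0 mul1r.
by congr (_%:E); rewrite addrC mulrC.
Qed.

Lemma gf_ge0 s N : 0 <= s -> (0 <= gf Q s N)%E.
Proof. by move=> s0; apply: integral_ge0 => w _; rewrite lee_fin exprn_ge0. Qed.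

Lemma gf_fin_num s N : measurable_fibers N -> 0 <= s <= 1 -> gf Q s N \is a fin_num.
Proof.
move=> mN /andP[s0 s1]; rewrite ge0_fin_numE; last exact: gf_ge0.
apply: (@le_lt_trans _ _ (\int[Q]_w cst 1%E w)%E); last first.
  rewrite integral_cst// mul1e.
  exact: (le_lt_trans (probability_le1 Q measurableT) (ltry 1)).
apply: ge0_le_integral => //.
- by move=> w _; rewrite lee_fin exprn_ge0.
- exact: (measurable_fibers_fun (fun j => (s ^+ j)%:E)).
- by move=> w _; rewrite lee_fin exprn_ile1.
Qed.

Lemma gf_indepD s M N : 0 <= s -> measurable_fibers M -> measurable_fibers N ->
  (forall a b, Q (M @^-1` [set a] `&` N @^-1` [set b]) =
     Q (M @^-1` [set a]) * Q (N @^-1` [set b]))%E ->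
  gf Q s (fun w => M w + N w)%N = (gf Q s M * gf Q s N)%E.
Proof.
move=> s0 mM mN MN.
have me K : measurable_fibers K -> measurable_fun setT (fun w => (s ^+ K w)%:E).
  by move=> mK; exact: (measurable_fibers_fun (fun j => (s ^+ j)%:E) mK).
rewrite /gf -ge0_integralZr//; first last.
- exact: gf_ge0.
- by move=> w _; rewrite lee_fin exprn_ge0.
- exact: me.
apply: (eq_integral_fibers mM) => [||w|w|a].
- by apply: me; exact: measurable_fibers_comp2.
- by apply: emeasurable_funM => //; exact: me.
- by rewrite lee_fin exprn_ge0.
- by rewrite mule_ge0 ?gf_ge0// lee_fin exprn_ge0.
transitivity (\int[Q]_(w in M @^-1` [set a]) ((s ^+ a)%:E * (s ^+ N w)%:E))%E.
  by apply: eq_integral => w /set_mem /= ->; rewrite exprD EFinM.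
rewrite ge0_integralZl//; first last.
- by rewrite lee_fin exprn_ge0.
- by move=> w _; rewrite lee_fin exprn_ge0.
- by apply: measurable_funTS; exact: me.
rewrite (integral_indep_event (h := fun j => s ^+ j) (mM a) mN)//; last first.
  by move=> j; rewrite exprn_ge0.
transitivity (\int[Q]_(w in M @^-1` [set a]) cst ((s ^+ a)%:E * gf Q s N) w)%E.
  rewrite integral_cst; last exact: mM.
  by rewrite -!muleA; congr (_ * _)%E; rewrite muleC.
by apply: eq_integral => w /set_mem /= ->.
Qed.

Lemma gf_choice s p (D : {RV Q >-> bool}) M N :
  0 <= s -> Q [set w | D w = true] = p%:E ->
  measurable_fibers M -> measurable_fibers N ->
  (forall b a, Q (D @^-1` [set b] `&` M @^-1` [set a]) =
     Q (D @^-1` [set b]) * Q (M @^-1` [set a]))%E ->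
  (forall b a, Q (D @^-1` [set b] `&` N @^-1` [set a]) =
     Q (D @^-1` [set b]) * Q (N @^-1` [set a]))%E ->
  gf Q s (fun w => if D w then M w else N w) =
  (p%:E * gf Q s M + (1 - p)%:E * gf Q s N)%E.
Proof.
move=> s0 Dp mM mN DM DN.
have mD : measurable_fibers D by exact: measurable_fibers_mfun.
rewrite {1}/gf (integral_split_bool D); first last.
- by move=> w; rewrite lee_fin exprn_ge0.
- apply: (measurable_fibers_fun (fun j => (s ^+ j)%:E)).
  apply: (measurable_fibers_bind
    (Z := fun (b : bool) w => if b then M w else N w)) => //.
  by case.
rewrite -{1}Dp -(probability_false Dp); congr (_ + _)%E.
  rewrite -(integral_indep_event (h := fun j => s ^+ j) (mD true) mM)//.
    by apply: eq_integral => w /set_mem /= ->.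
  by move=> j; rewrite exprn_ge0.
rewrite -(integral_indep_event (h := fun j => s ^+ j) (mD false) mN)//.
  by apply: eq_integral => w /set_mem /= ->.
by move=> j; rewrite exprn_ge0.
Qed.

(** Conditionally on [Y = f], the left-hand exponent is a sum of [\sum_i f i]
    independent Bernoulli(c) variables, so the conditional expectation is
    [(1 - c + c * s) ^+ \sum_i f i]. The vector [Y] is encoded as a
    finite function, which makes it a single countably-valued variable to
    condition on. *)
Lemma gf_sum_thinning (I : finType) c s (Y : I -> {RV Q >-> nat})
    (B : I -> nat -> {RV Q >-> bool}) :
  0 <= s -> 0 <= 1 - c + c * s ->
  mutually_indep (fun ij : I * nat => B ij.1 ij.2) ->
  (forall i j, Q [set w | B i j w = true] = c%:E) ->
  indep_sigma Q (sigma_rv (fun ij : I * nat => B ij.1 ij.2)) (sigma_rv Y) ->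
  gf Q s (fun w => \sum_i thinning (B i) (Y i) w)%N =
  gf Q (1 - c + c * s) (fun w => \sum_i Y i w)%N.
Proof.
move=> s0 t0 indB Bc BY; set t := 1 - c + c * s.
have mB i j : measurable_fibers (B i j) by exact: measurable_fibers_mfun.
have mY i : measurable_fibers (Y i) by exact: measurable_fibers_mfun.
pose y w := [ffun i => Y i w].
have my : measurable_fibers y by exact: measurable_fibers_finfun.
pose Z (f : {ffun I -> nat}) w := (\sum_i \sum_(0 <= j < f i) B i j w)%N.
have mZ f : measurable_fibers (Z f).
  apply: (@measurable_fibers_sum _ _ _ _ (fun i w => \sum_(0 <= j < f i) B i j w)%N) => i.
  exact: measurable_fibers_count.
have gfZ f : gf Q s (Z f) = (t ^+ (\sum_i f i))%:E.
  pose J := [seq (i, j) | i <- index_enum I, j <- index_iota 0 (f i)].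
  have uJ : uniq J.
    apply: allpairs_uniq_dep => [|i _|[i j] [i' j'] _ _ [-> ->]//].
      exact: index_enum_uniq.
    exact: iota_uniq.
  transitivity (\int[Q]_w (\prod_(ij <- J) s ^+ B ij.1 ij.2 w)%:E)%E.
    apply: eq_integral => w _; rewrite /Z /J big_allpairs_dep/= expr_sum.
    by congr (_%:E); apply: eq_bigr => i _; rewrite expr_sum.
  rewrite (@integral_prod_indep _ _ _ Q _ bool (fun ij => B ij.1 ij.2)
    (fun _ b => s ^+ b))//; first last.
  - exact: mutually_indep_fibers.
  - by move=> _ b; rewrite exprn_ge0.
  transitivity (\prod_(ij <- J) t%:E)%E.
    by apply: eq_bigr => ij _; exact: (gf_bernoulli s0 (Bc _ _)).
  rewrite prodEFin /J big_allpairs_dep/= expr_sum; congr (_%:E).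
  by apply: eq_bigr => i _; rewrite big_const_seq count_predT size_iota subn0 iter_mulr_1.
have indZ f a : (Q (y @^-1` [set f] `&` Z f @^-1` [set a]) =
    Q (y @^-1` [set f]) * Q (Z f @^-1` [set a]))%E.
  rewrite setIC muleC; apply: BY.
    apply: fibers_in_sigma_rv; rewrite /fibers_in /Z.
    apply: measurable_fibers_sum => i.
    apply: measurable_fibers_count => j.
    exact: (@sigma_rv_fibers _ _ _ _ _ (fun ij : I * nat => B ij.1 ij.2) (i, j)).
  apply: fibers_in_sigma_rv; apply: measurable_fibers_finfun => i.
  exact: sigma_rv_fibers.
apply: (eq_integral_fibers my) => [||w|w|f].
- apply: (measurable_fibers_fun (fun j => (s ^+ j)%:E)).
  apply: (@measurable_fibers_sum _ _ _ _ (fun i => thinning (B i) (Y i))) => i.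
  exact: measurable_fibers_thinning.
- apply: (measurable_fibers_fun (fun j => (t ^+ j)%:E)).
  exact: measurable_fibers_sum.
- by rewrite lee_fin exprn_ge0.
- by rewrite lee_fin exprn_ge0.
transitivity (\int[Q]_(w in y @^-1` [set f]) (s ^+ Z f w)%:E)%E.
  apply: eq_integral => w /set_mem /= <-; congr ((_ ^+ _)%:E).
  by apply: eq_bigr => i _; rewrite ffunE.
rewrite (integral_indep_event (h := fun j => s ^+ j) (my f) (mZ f))//; last first.
  by move=> j; rewrite exprn_ge0.
rewrite -/(gf _ _ _) gfZ muleC -integral_cst; last exact: my.
apply: eq_integral => w /set_mem /= <-; congr ((_ ^+ _)%:E).
by apply: eq_bigr => i _; rewrite ffunE.
Qed.

End gf.

(** * The functional equation of the model *)

(** The generating function of the recursion itself. The sums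
    over [i] are kept together because the recursion relates only the sums;
    they become [k]-th powers afterwards. *)
Lemma stationary_inar1_gf (R : realType) (k : nat) (c p : R)
    (d : measure_display) (T : measurableType d) (Q : probability T R)
    (Y eps : int -> 'I_k -> {RV Q >-> nat})
    (B : int -> 'I_k -> nat -> {RV Q >-> bool}) (D : int -> {RV Q >-> bool})
    (n : int) (s : R) :
  stationary_inar1 c p Y eps B D -> 0 <= s -> 0 <= 1 - c + c * s ->
  (gf Q s (fun w => \sum_(i < k) Y n i w)%N =
   gf Q s (fun w => \sum_(i < k) eps n i w)%N *
   (p%:E + (1 - p)%:E *
     gf Q (1 - c + c * s) (fun w => \sum_(i < k) Y (n - 1)%R i w)%N))%E.
Proof.
move=> M s0 t0; have Dp := inar1_D_law M n.
(* [p] lies in [0, 1] because it is a probability; distributivity in the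
   extended reals asks for these signs. *)
have p01 : (0 <= p%:E)%E /\ (0 <= (1 - p)%:E)%E.
  rewrite -Dp measure_ge0; split => //.
  have mD : measurable [set w | D n w = true].
    exact: (@measurable_fibers_mfun _ _ _ _ (D n) _ true).
  by have := probability_le1 Q mD; rewrite Dp !lee_fin subr_ge0.
pose S w := (\sum_(i < k) thinning (B n i) (Y (n - 1)%R i) w)%N.
pose E w := (\sum_(i < k) eps n i w)%N.
have mY i : measurable_fibers (Y n i) by exact: measurable_fibers_mfun.
have mE : measurable_fibers E.
  by apply: measurable_fibers_sum => i; exact: measurable_fibers_mfun.
have mS : measurable_fibers S.
  apply: measurable_fibers_sum => i.
  by apply: measurable_fibers_thinning => [j|]; exact: measurable_fibers_mfun.
have mSE : measurable_fibers (fun w => S w + E w)%N.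
  exact: (measurable_fibers_comp2 addn).
pose FY := sigma_rv (Y (n - 1)).
pose Feps := sigma_rv (eps n).
pose FB := sigma_rv (fun ij : 'I_k * nat => B n ij.1 ij.2).
have FE G : Feps `<=` G -> fibers_in G E.
  move=> FG; apply: measurable_fibers_sum => i.
  by apply: (fibers_in_sub FG); exact: sigma_rv_fibers.
have FS G : FY `<=` G -> FB `<=` G -> fibers_in G S.
  move=> FYG FBG; apply: measurable_fibers_sum => i.
  apply: measurable_fibers_thinning => [j|].
    apply: (fibers_in_sub FBG).
    exact: (@sigma_rv_fibers _ _ _ _ _ (fun ij : 'I_k * nat => B n ij.1 ij.2) (i, j)).
  by apply: (fibers_in_sub FYG); exact: sigma_rv_fibers.
have indD Z : fibers_in (FY `|` Feps `|` FB) Z -> forall b (a : nat),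
    (Q (D n @^-1` [set b] `&` Z @^-1` [set a]) =
     Q (D n @^-1` [set b]) * Q (Z @^-1` [set a]))%E.
  move=> FZ b a; apply: (inar1_D_YepsB M); last exact: FZ.
  apply: fibers_in_sigma_rv.
  exact: (@sigma_rv_fibers _ _ _ _ _ (fun _ : unit => D n) tt).
have FE3 : fibers_in (FY `|` Feps `|` FB) E.
  by apply: FE => A FA; left; right.
have FS2 : fibers_in (FY `|` FB) S by apply: FS => A FA; [left|right].
have FS3 : fibers_in (FY `|` Feps `|` FB) S.
  by apply: FS => A FA; [left; left|right].
transitivity (gf Q s (fun w => if D n w then E w else (S w + E w)%N)).
  apply: ge0_ae_eq_integral => //.
  - apply: (measurable_fibers_fun (fun j => (s ^+ j)%:E)).
    exact: measurable_fibers_sum.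
  - apply: (measurable_fibers_fun (fun j => (s ^+ j)%:E)).
    apply: (measurable_fibers_bind (X := D n)
      (Z := fun (b : bool) w => if b then E w else (S w + E w)%N)).
      exact: measurable_fibers_mfun.
    by case.
  - by move=> w _; rewrite lee_fin exprn_ge0.
  - by move=> w _; rewrite lee_fin exprn_ge0.
  - by apply: filterS (inar1_rec M n) => w /= + _ => ->.
rewrite (gf_choice s0 Dp mE mSE); first last.
- by apply: indD; exact: (measurable_fibers_comp2 addn).
- exact: indD.
rewrite gf_indepD//; last first.
  move=> a b; rewrite setIC muleC; apply: (inar1_eps_YB M); last exact: FS2.
  by apply: fibers_in_sigma_rv; exact: FE.
rewrite [gf Q s S](gf_sum_thinning s0 t0 (inar1_B_indep M n) (inar1_B_law M n)
  (inar1_B_Y M (n := n))).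
case: p01 => p0 q0; rewrite [RHS](ge0_muleDr _ p0 (mule_ge0 q0 (gf_ge0 _ _ t0))).
rewrite [(p%:E * _)%E]muleC; congr (_ + _)%E.
by rewrite muleA muleC.
Qed.

(** * Self-decomposability *)

Theorem proposition3 (R : realType) (k : nat) (k_ge1 : (1 <= k)%N)
    (PY : R -> R) (PY_pgf : is_pgf PY)
    (models : forall c p : R, 0 < c <= 1 -> 0 <= p < 1 ->
      exists (d : measure_display) (T : measurableType d) (Q : probability T R)
             (Y eps : int -> 'I_k -> {RV Q >-> nat})
             (B : int -> 'I_k -> nat -> {RV Q >-> bool})
             (D : int -> {RV Q >-> bool}),
        stationary_inar1 c p Y eps B D /\
        forall n i, has_pgf (distribution Q (Y n i)) PY) :
  dhrsd k PY.
Proof.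
split => // c p /[dup] cI /andP[c0 c1] /[dup] pI /andP[p0 p1].
have [d [T [Q [Y [eps [B [D [M YP]]]]]]]] := models c p cI pI.
pose i0 := Ordinal k_ge1.
pose Pe s := fine (gf Q s (eps 0 i0)).
have gfY n i (s : R) : 0 <= s <= 1 -> gf Q s (Y n i) = (PY s)%:E.
  by move=> s01; rewrite gf_distribution ?YP//; case/andP: s01.
have gfe (s : R) : 0 <= s <= 1 -> gf Q s (eps 0 i0) = (Pe s)%:E.
  move=> s01; rewrite /Pe fineK// gf_fin_num//.
  exact: measurable_fibers_mfun.
exists Pe.
  exists (distribution Q (eps 0 i0)) => s s01.
  by rewrite -gfe// gf_distribution//; case/andP: s01.
move=> s s01; have /andP[s0 s1] := s01.
set t := 1 - c + c * s.
have t01 : 0 <= t <= 1.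
  apply/andP; split; first by rewrite addr_ge0 ?subr_ge0 ?mulr_ge0// ltW.
  by rewrite /t -addrA gerDl addrC subr_le0 ler_piMr// ltW.
have t0 : 0 <= t by case/andP: t01.
have PY0 (u : R) : 0 <= u <= 1 -> 0 <= PY u.
  by move=> u01; rewrite -lee_fin -(gfY 0 i0)//; apply: gf_ge0; case/andP: u01.
have Pe0 : 0 <= Pe s by rewrite -lee_fin -gfe//; exact: gf_ge0.
have prodk (u : R) : (\prod_(i < k) u%:E = (u ^+ k)%:E)%E.
  by rewrite prodEFin prodr_const card_ord.
have gfsY n (u : R) : 0 <= u <= 1 ->
    gf Q u (fun w => \sum_(i < k) Y n i w)%N = (PY u ^+ k)%:E.
  move=> u01; rewrite gf_sum ?index_enum_uniq//; first last.
  - by case/andP: u01.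
  - exact: (inar1_Y_iid M n).1.
  by rewrite -prodk; apply: eq_bigr => i _; exact: gfY.
have [indeps eqeps] := inar1_eps_iid M.
have gfse : gf Q s (fun w => \sum_(i < k) eps 0 i w)%N = (Pe s ^+ k)%:E.
  rewrite gf_sum ?index_enum_uniq//; last first.
    exact: (mutually_indep_can (f := fun i => (0, i)) (g := snd)) indeps.
  rewrite -prodk; apply: eq_bigr => i _.
  rewrite -gfe// !gf_distribution//; apply: eq_eseriesr => j _.
  by rewrite (eqeps (0, i) (0, i0)).
have key : PY s ^+ k = Pe s ^+ k * (p + (1 - p) * PY t ^+ k).
  apply/EFin_inj; rewrite -(gfsY 0 s s01) (stationary_inar1_gf 0 M s0 t0).
  by rewrite gfse gfsY.
have root (u : R) : 0 <= u -> u = (u ^+ k) `^ k%:R^-1.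
  by move=> u0; rewrite -powR_mulrn// -powRrM mulfV ?powRr1 ?pnatr_eq0 -?lt0n.
rewrite (root (PY s)) ?PY0// key powRM.
- by rewrite -root.
- exact: exprn_ge0.
- by rewrite addr_ge0// mulr_ge0 ?subr_ge0 ?exprn_ge0 ?PY0// ltW.
Qed.
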